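(* If a sequence $(x_n)_{n\geq 1}$ in $[0,1)$ has Poissonian pair correlations, then it is uniformly distributed in $[0,1)$.
   Context: For a real number $y$, $\|y\|$ denotes the distance from $y$ to the nearest integer, and $\#$ denotes cardinality. A sequence $(x_n)_{n \geq 1}$ of real numbers in $[0,1)$ has Poissonian pair correlations if $$\lim_{N \rightarrow \infty} \frac{1}{N} \# \left\{ 1 \leq l \neq m \leq N \, : \, \|x_l-x_m\| < \frac{s}{N} \right\} = 2s$$ for every real $s>0$, where the set consists of ordered pairs $(l,m)$ of distinct indices in $\{1,\ldots,N\}$. The sequence $(x_n)_{n\geq 1}$ is uniformly distributed in $[0,1)$ if $$\lim_{N \rightarrow \infty} \frac{1}{N} \# \left\{ 1 \leq n \leq N \, : \, x_n \in [a,b) \right\} = b-a$$ for all $0 \leq a \leq b \leq 1$. *)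

(* Defs.v *)
From mathcomp Require Import all_boot all_order all_algebra.
From mathcomp Require Import all_classical all_reals all_analysis.

Set Implicit Arguments.
Unset Strict Implicit.
Unset Printing Implicit Defensive.

Import Order.TTheory GRing.Theory Num.Theory.
Import numFieldNormedType.Exports.

Local Open Scope classical_set_scope.
Local Open Scope ring_scope.


(* A sequence (x_n)_{n >= 1} is a function x : nat -> R whose value at 0 is
   never used: an index n in {1, ..., N} is represented by i.+1, i : 'I_N. *)

(* Distance of y to the set of integers; the infimum is attained. *)
Definition dist_int (R : realType) (y : R) : R :=
  inf (range (fun k : int => `|y - k%:~R|)).

Definition pair_count (R : realType) (x : nat -> R) (s : R) (N : nat) : nat :=
  #|[pred p : 'I_N * 'I_N |
      (p.1 != p.2) && (dist_int (x p.1.+1 - x p.2.+1) < s / N%:R)]|.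

Definition poissonian_pair_correlations (R : realType) (x : nat -> R) : Prop :=
  forall s : R, 0 < s ->
    (fun N : nat => N%:R^-1 * (pair_count x s N)%:R : R) @ \oo --> 2 * s.

Definition interval_count (R : realType) (x : nat -> R) (a b : R) (N : nat)
    : nat :=
  #|[pred i : 'I_N | x i.+1 \in `[a, b[%R]|.

Definition uniformly_distributed (R : realType) (x : nat -> R) : Prop :=
  forall a b : R, 0 <= a -> a <= b -> b <= 1 ->
    (fun N : nat => N%:R^-1 * (interval_count x a b N)%:R : R) @ \oo --> b - a.

(* Main.v *)
Require Import Defs.
From mathcomp Require Import all_boot all_order all_algebra.
From mathcomp Require Import all_classical all_reals all_analysis.
From mathcomp Require Import zify ring lra.

(** Poissonian pair correlations say that a window of length L/N, slid around
    the unit interval, catches the first N points with a variance of order L,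
    while its average catch is L. If the points were badly distributed, windows
    starting in some prefix [0, b) would deviate from L systematically, by a
    fixed proportion of L, hence would produce a variance of order L^2. Letting
    L grow gives a contradiction.

    Quantitatively, the unit interval is cut into N cells of length 1/N, and
    [f t] ([occupancy]) counts the points whose cell is one of the L cells
    ending at t. Each point is counted L times, so the values of f sum to L N
    ([sum_occupancy]). In the sum of the squares of f, a pair of points at
    distance d cells is counted (L - d)^+ times, which is the number of
    j < L with d <= j; points at most j cells apart are at distance less than
    (j + 1)/N. Therefore ([sum_occupancy_sqr_le], [close_pairs_cell_le])

      sum f^2 <= L N + sum_(j < L) pair_count (j + 1),

    and by hypothesis the right-hand side is eventually at most
    L N + N sum_(j < L) (2 (j + 1) + 1) = N (L^2 + 3 L). The terms in L^2 cancel
    in the variance: sum (f - L)^2 <= 4 L N once N >= L^2. By the Cauchy-Schwarz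
    inequality, the sum of f - L over any prefix is O(N sqrt L)
    ([prefix_dev_le]); up to L windows at the end of [0, b), the sum of f over
    that prefix is L times the number of points in it ([prefix_count_bounds]).
    Dividing by L N, the proportion of points in [0, b) differs from b by
    O(1 / sqrt L) + O(L / N) ([prefix_count_dev]). Intervals [a, b) follow by
    difference.

    Windows are not wrapped around the circle: distances between integers are
    easier to handle than cyclic ones, and this only adds L boundary windows,
    whose effect vanishes as N grows. *)

Set Implicit Arguments.
Unset Strict Implicit.
Unset Printing Implicit Defensive.

Import Order.TTheory GRing.Theory Num.Theory.
Import numFieldNormedType.Exports.

Local Open Scope ring_scope.

(** * Counting points in sliding windows *)

Lemma sum_nat_interval (a b M : nat) :
  (\sum_(0 <= t < M) ((a <= t < b) : nat) = minn b M - a)%N.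
Proof.
elim: M => [|M IH]; first by rewrite big_nil; lia.
by rewrite big_nat_recr //= IH; lia.
Qed.

(** The number of indices whose value lies in the window of length L whose last
    element is t. Windows are indexed by their end so that, for y >= 0, all
    the L windows around a point have a natural number as index. *)
Definition occupancy (I : finType) (y : I -> nat) (L t : nat) : nat :=
  \sum_i ((y i <= t < y i + L)%N : nat).

(** The pairs are ordered, and the condition is |y p.1 - y p.2| <= j, written
    without truncated subtraction. *)
Definition close_pairs (I : finType) (y : I -> nat) (j : nat) : nat :=
  #|[pred p : I * I |
      (p.1 != p.2) && (y p.1 <= y p.2 + j)%N && (y p.2 <= y p.1 + j)%N]|.

Lemma sum_occupancy (I : finType) (y : I -> nat) (L N : nat) :
  (forall i, y i < N)%N ->
  (\sum_(0 <= t < N + L) occupancy y L t = #|I| * L)%N.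
Proof.
move=> yN; rewrite exchange_big -sum_nat_const; apply: eq_bigr => i _.
by rewrite sum_nat_interval; have := yN i; lia.
Qed.

(** Both sides would be (L - |y - z|)^+ if all windows were counted. On the left
    this is the length of the intersection of two intervals of length L; on the
    right it is a layer-cake decomposition, which is what brings in the pairs
    at each distance threshold j. *)
Lemma window_overlap_le (y z L M : nat) :
  (\sum_(0 <= t < M) ((y <= t < y + L) * (z <= t < z + L))
     <= \sum_(0 <= j < L) ((y <= z + j) && (z <= y + j)))%N.
Proof.
rewrite (eq_bigr (fun t => ((maxn y z <= t < minn y z + L) : nat))); last first.
  by move=> t _; rewrite mulnb; congr nat_of_bool; lia.
rewrite [leqRHS](eq_big_nat _ _
  (F2 := fun j => ((maxn y z - minn y z <= j < L) : nat))); last first.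
  by move=> j jL; congr nat_of_bool; lia.
by rewrite !sum_nat_interval; lia.
Qed.

(** Expanding the square gives pairs of indices: a diagonal pair lies in L
    common windows, an off-diagonal one is bounded by [window_overlap_le]. *)
Lemma sum_occupancy_sqr_le (I : finType) (y : I -> nat) (L M : nat) :
  (\sum_(0 <= t < M) occupancy y L t ^ 2
     <= #|I| * L + \sum_(0 <= j < L) close_pairs y j)%N.
Proof.
have -> : (\sum_(0 <= t < M) occupancy y L t ^ 2 =
    \sum_(p : I * I) \sum_(0 <= t < M)
      ((y p.1 <= t < y p.1 + L) * (y p.2 <= t < y p.2 + L)))%N.
  rewrite exchange_big; apply: eq_bigr => t _.
  by rewrite -mulnn big_distrlr pair_bigA.
pose near_in (j : nat) (p : I * I) :=
  (p.1 != p.2) && (y p.1 <= y p.2 + j)%N && (y p.2 <= y p.1 + j)%N.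
apply: (@leq_trans (\sum_(p : I * I)
    ((p.1 == p.2) * L + \sum_(0 <= j < L) near_in j p))%N).
  apply: leq_sum => -[i k] _ /=; have [<-|ik] := eqVneq i k.
    rewrite mul1n (eq_bigr (fun t => ((y i <= t < y i + L) : nat)%N)).
      by rewrite sum_nat_interval; lia.
    by move=> t _; rewrite mulnb andbb.
  rewrite mul0n add0n; apply: leq_trans (window_overlap_le _ _ _ _) _.
  by apply: leq_sum => j _; rewrite /near_in /= ik.
rewrite big_split /= leq_add //.
  rewrite -(pair_bigA _ (fun i k => (i == k) * L)%N) /= -sum_nat_const.
  apply: leq_sum => i _; rewrite (bigD1 i) //= eqxx mul1n big1 ?addn0 //.
  by move=> k; rewrite eq_sym => /negPf ->.
rewrite exchange_big leq_sum // => j _.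
by rewrite /close_pairs -sum1_card [leqRHS]big_mkcond leq_sum.
Qed.

(** * Variance and prefix sums *)

Lemma sum_sqr_dev (R : realType) (f : nat -> nat) (l : R) (M : nat) :
  \sum_(0 <= t < M) ((f t)%:R - l) ^+ 2 =
  (\sum_(0 <= t < M) f t ^ 2)%:R - 2 * l * (\sum_(0 <= t < M) f t)%:R
    + M%:R * l ^+ 2.
Proof.
elim: M => [|M IH]; first by rewrite !big_nil !mul0r; ring.
rewrite !big_nat_recr //= IH !natrD natrX -natr1; ring.
Qed.

(** A Cauchy-Schwarz inequality in additive form: |u| <= u^2/(2c) + c/2. The
    free parameter c is to be chosen of the order of the root mean square of
    f - l, and replaces a square root. *)
Lemma prefix_dev_le (R : realType) (f : nat -> nat) (l c : R) (T M : nat) :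
  0 < c -> (T <= M)%N ->
  `|(\sum_(0 <= t < T) f t)%:R - T%:R * l| <=
    (\sum_(0 <= t < M) ((f t)%:R - l) ^+ 2) / (2 * c) + M%:R * c / 2.
Proof.
move=> c0 TM.
have -> : (\sum_(0 <= t < T) f t)%:R - T%:R * l =
    \sum_(0 <= t < T) ((f t)%:R - l).
  by rewrite sumrB -natr_sum sumr_const_nat subn0 mulr_natl.
apply: le_trans (ler_norm_sum _ _ _) _.
have amgm t : `|(f t)%:R - l| <= ((f t)%:R - l) ^+ 2 / (2 * c) + c / 2.
  rewrite -[X in X / _]real_normK ?num_real // -subr_ge0.
  set u := `|_|.
  have -> : u ^+ 2 / (2 * c) + c / 2 - u = (u - c) ^+ 2 / (2 * c).
    by field; rewrite gt_eqF.
  by rewrite divr_ge0 ?sqr_ge0 // mulr_ge0 // ltW.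
apply: (@le_trans _ _ (\sum_(0 <= t < M)
    (((f t)%:R - l) ^+ 2 / (2 * c) + c / 2))).
  rewrite (big_cat_nat (leq0n T) TM) /= -[leLHS]addr0 lerD ?ler_sum //.
  by apply: sumr_ge0 => t _; exact: le_trans (amgm t).
by rewrite big_split /= -mulr_suml sumr_const_nat subn0
  -[M%:R * c / 2]mulrA [M%:R * _]mulr_natl.
Qed.
(** * Cells of length 1/N *)

Lemma dist_int_le_norm (R : realType) (y : R) : dist_int y <= `|y|.
Proof.
apply: ge_inf; first by exists 0 => _ [k _ <-].
by exists 0 => //; rewrite subr0.
Qed.

Definition cell (R : realType) (x : nat -> R) (N : nat) (i : 'I_N) : nat :=
  Num.truncn (N%:R * x i.+1).

Section Cells.
Variables (R : realType) (x : nat -> R) (N : nat).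
Hypothesis x01 : forall n : nat, (1 <= n)%N -> 0 <= x n < 1.
Hypothesis N_gt0 : (0 < N)%N.

Let N_gt0R : 0 < N%:R :> R. Proof. by rewrite ltr0n. Qed.

Lemma cell_itv (i : 'I_N) :
  (cell x i)%:R <= N%:R * x i.+1 < (cell x i).+1%:R.
Proof.
by apply: truncn_itv; rewrite mulr_ge0 //; case/andP: (@x01 i.+1 isT).
Qed.

Lemma cell_lt (i : 'I_N) : (cell x i < N)%N.
Proof.
have /andP[x0 x1] := @x01 i.+1 isT.
by rewrite truncn_lt_nat ?mulr_ge0 // gtr_pMr.
Qed.

Lemma close_pairs_cell_le (j : nat) :
  (close_pairs (@cell R x N) j <= pair_count x j.+1%:R N)%N.
Proof.
apply/subset_leq_card/fintype.subsetP => -[i k].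
rewrite !inE /= => /andP[/andP[-> yik] yki] /=.
apply: le_lt_trans (dist_int_le_norm _) _.
rewrite ltr_pdivlMr // -[X in _ * X]gtr0_norm // -normrM mulrC mulrBr.
have /andP[li ui] := cell_itv i; have /andP[lk uk] := cell_itv k.
rewrite -(ler_nat R) natrD in yik; rewrite -(ler_nat R) natrD in yki.
rewrite -natr1 in ui; rewrite -natr1 in uk.
by rewrite ltr_norml -natr1; apply/andP; split; lra.
Qed.

(** A point of [0, b) has its cell at or before T, so its L windows all end
    before T + L; a point with a window ending before T has its cell strictly
    before T, hence lies in [0, b). *)
Lemma prefix_count_bounds (b : R) (L : nat) :
  let T := Num.truncn (N%:R * b) in
  (\sum_(0 <= t < T) occupancy (@cell R x N) L t
     <= interval_count x 0 b N * L
     <= \sum_(0 <= t < T + L) occupancy (@cell R x N) L t)%N.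
Proof.
set T := Num.truncn (N%:R * b) => /=.
have sumE W : (\sum_(0 <= t < W) occupancy (@cell R x N) L t =
    \sum_(i < N) (minn (cell x i + L) W - cell x i))%N.
  by rewrite exchange_big; apply: eq_bigr => i _; exact: sum_nat_interval.
have -> : (interval_count x 0 b N * L = \sum_(i < N) (x i.+1 < b)%R * L)%N.
  rewrite -big_distrl /= /interval_count -sum1_card big_mkcond /=.
  congr (_ * _)%N; apply: eq_bigr => i _; rewrite -topredE /= in_itv /=.
  by have /andP[-> _] := @x01 i.+1 isT; case: (_ < _).
rewrite !sumE; apply/andP; split; apply: leq_sum => i _.
  case: ltP => [_|bx]; first lia.
  have : (T <= cell x i)%N by apply: le_truncn; rewrite ler_pM2l.
  lia.
case: ltP => [xb|_]; last lia.
have : (cell x i <= T)%N by apply: le_truncn; rewrite ler_pM2l // ltW.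
lia.
Qed.

(** The variance bound 4 L N is fed into [prefix_dev_le] with c = e L. The
    condition 2 <= e^2 L makes the error from the variance, 2 N / e, at most
    e L N; the other two conditions make N large enough for the boundary windows
    to be negligible. *)
Lemma prefix_count_dev (b e : R) (L : nat) :
    0 <= b <= 1 -> 0 < e -> (0 < L)%N ->
    2 <= e ^+ 2 * L%:R -> (L ^ 2 <= N)%N -> L%:R + 1 <= e * N%:R ->
    (forall j, (j < L)%N ->
      (pair_count x j.+1%:R N)%:R <= (2 * j.+1%:R + 1) * N%:R :> R) ->
  `|b - N%:R^-1 * (interval_count x 0 b N)%:R| <= 3 * e.
Proof.
move=> /andP[b0 b1] e0 L0 eL LN LeN pcN.
have L0R : 0 < L%:R :> R by rewrite ltr0n.
have L2N : L%:R ^+ 2 <= N%:R :> R by rewrite -natrX ler_nat.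
have L_le_N : L%:R <= N%:R :> R by rewrite ler_nat; nia.
pose f t := occupancy (@cell R x N) L t.
(* The sum over j < K of 2 (j + 1) + 1 is K^2 + 2 K. *)
have pairs_le : (\sum_(0 <= j < L) close_pairs (@cell R x N) j)%:R
    <= (L%:R ^+ 2 + 2 * L%:R) * N%:R :> R.
  have : forall K, (K <= L)%N ->
      (\sum_(0 <= j < K) close_pairs (@cell R x N) j)%:R
        <= (K%:R ^+ 2 + 2 * K%:R) * N%:R :> R.
    elim=> [|K IH] KL; first by rewrite big_nil expr0n mulr0 addr0 mul0r.
    rewrite big_nat_recr //= natrD.
    have := IH (ltnW KL); have := pcN K KL.
    have : (close_pairs (@cell R x N) K)%:R
        <= (pair_count x K.+1%:R N)%:R :> R.
      by rewrite ler_nat close_pairs_cell_le.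
    rewrite -natr1; lra.
  exact.
have sqr_dev_le : \sum_(0 <= t < N + L) ((f t)%:R - L%:R) ^+ 2
    <= 4 * L%:R * N%:R :> R.
  have := sum_occupancy_sqr_le (@cell R x N) L (N + L).
  rewrite card_ord -(ler_nat R) natrD natrM => sqr_le.
  rewrite sum_sqr_dev sum_occupancy; last exact: cell_lt.
  rewrite card_ord natrM natrD.
  have : L%:R * L%:R ^+ 2 <= L%:R * N%:R :> R by rewrite ler_pM2l.
  rewrite /f; lra.
(* The number of windows is N + L <= 2 N, so the two halves of the bound of
   prefix_dev_le are each at most e N L. *)
have prefix_le W : (W <= N + L)%N ->
    `|(\sum_(0 <= t < W) f t)%:R - W%:R * L%:R| <= 2 * e * N%:R * L%:R.
  move=> WNL; have c0 : 0 < e * L%:R by rewrite mulr_gt0.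
  apply: le_trans (prefix_dev_le f L%:R c0 WNL) _.
  have -> : 2 * e * N%:R * L%:R = e * N%:R * L%:R + e * N%:R * L%:R by ring.
  rewrite lerD //.
    rewrite ler_pdivrMr ?mulr_gt0 //; apply: le_trans sqr_dev_le _.
    have : 2 * (2 * L%:R * N%:R) <= e ^+ 2 * L%:R * (2 * L%:R * N%:R).
      by rewrite ler_wpM2r // !mulr_ge0.
    lra.
  rewrite natrD.
  have : e * L%:R * L%:R <= e * L%:R * N%:R by rewrite ler_pM2l.
  lra.
pose T := Num.truncn (N%:R * b).
have /andP[Tl Tu] : T%:R <= N%:R * b < T.+1%:R.
  by apply: truncn_itv; rewrite mulr_ge0.
have TN : (T <= N)%N.
  by rewrite -(ler_nat R); apply: le_trans Tl _; rewrite ger_pMr.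
have /andP[lo hi] := prefix_count_bounds b L.
have := prefix_le T (leq_trans TN (leq_addr _ _)).
have := prefix_le (T + L)%N; rewrite leq_add2r => /(_ TN).
rewrite -(ler_nat R) natrM in lo; rewrite -(ler_nat R) natrM in hi.
rewrite -/T -/f in lo hi.
rewrite !ler_norml => /andP[_ hi'] /andP[lo' _].
set A := (interval_count x 0 b N)%:R in lo hi *.
have A_ge : T%:R - 2 * e * N%:R <= A.
  by rewrite -(ler_pM2r L0R); lra.
have A_le : A <= T%:R + L%:R + 2 * e * N%:R.
  by rewrite -(ler_pM2r L0R); move: hi'; rewrite natrD; lra.
have -> : b - N%:R^-1 * A = (N%:R * b - A) / N%:R.
  by field; rewrite gt_eqF.
rewrite ler_pdivrMr // ler_pdivlMr //; rewrite -natr1 in Tu.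
by apply/andP; split; lra.
Qed.

End Cells.

Local Open Scope classical_set_scope.

Lemma prefix_count_cvg (R : realType) (x : nat -> R) (b : R) :
    (forall n : nat, (1 <= n)%N -> 0 <= x n < 1) ->
    poissonian_pair_correlations x -> 0 <= b <= 1 ->
  (fun N : nat => N%:R^-1 * (interval_count x 0 b N)%:R : R) @ \oo --> b.
Proof.
move=> x01 xP b01; apply/cvgrPdist_le => eps eps0.
pose e := eps / 3; have e0 : 0 < e by rewrite divr_gt0.
pose L := (Num.truncn (2 / e ^+ 2)).+1.
have eL : 2 <= e ^+ 2 * L%:R.
  by rewrite mulrC -ler_pdivrMr ?exprn_gt0 // ltW // truncnS_gt.
have pcN : \forall N \near \oo, forall j : 'I_L,
    N%:R^-1 * (pair_count x j.+1%:R N)%:R <= 2 * j.+1%:R + 1 :> R.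
  apply: filter_forall => j.
  by apply: cvgr_le (xP j.+1%:R _) _ _; rewrite ?ltr0n // ltrDl.
near=> N.
have N0 : (0 < N)%N by near: N; exact: nbhs_infty_gt.
have -> : eps = 3 * e by rewrite /e; field.
apply: (prefix_count_dev (L := L) x01 N0) => //.
- by near: N; exact: nbhs_infty_ge.
- by rewrite mulrC -ler_pdivrMr //; near: N; exact: nbhs_infty_ger.
- move=> j jL; rewrite -ler_pdivrMr ?ltr0n // mulrC.
  exact: (near pcN N _ (Ordinal jL)).
Unshelve. all: by end_near.
Qed.

Lemma interval_countB (R : realType) (x : nat -> R) (a b : R) (N : nat) :
    0 <= a -> a <= b ->
  (interval_count x 0 b N = interval_count x 0 a N + interval_count x a b N)%N.
Proof.
move=> a0 ab; rewrite /interval_count -!sum1_card.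
rewrite (bigID (fun i : 'I_N => x i.+1 < a)) /=.
congr addn; apply: eq_bigl => i; rewrite -!topredE /= !in_itv /=.
  by have [xa|] := ltP (x i.+1) a; rewrite ?andbF // (lt_le_trans xa ab) !andbT.
have [//|ax] := ltP (x i.+1) a; rewrite ?andbF // ?andbT.
by rewrite (le_trans a0 ax).
Qed.

Theorem corollary2 (R : realType) (x : nat -> R)
    (x01 : forall n : nat, (1 <= n)%N -> 0 <= x n < 1)
    (xP : poissonian_pair_correlations x) :
  uniformly_distributed x.
Proof.
move=> a b a0 ab b1.
have a01 : 0 <= a <= 1 by rewrite a0 (le_trans ab).
have b01 : 0 <= b <= 1 by rewrite (le_trans a0 ab).
have -> : (fun N : nat => N%:R^-1 * (interval_count x a b N)%:R : R) =
    (fun N => N%:R^-1 * (interval_count x 0 b N)%:R)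
    \- (fun N => N%:R^-1 * (interval_count x 0 a N)%:R).
  by apply/funext => N /=; rewrite (interval_countB x N a0 ab) natrD; ring.
exact: cvgB (prefix_count_cvg x01 xP b01) (prefix_count_cvg x01 xP a01).
Qed.
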